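(* Let $\tau\in\mathfrak S_k$ with $k\ge4$. (i) If $\tau\notin\{2143,3412,2413,3142\}$, then $|\mathrm{Av}_n(\mathrm{Box}(\tau))|\ge\lfloor n/2\rfloor!$ for every $n\ge 0$, so $\mathrm{Box}(\tau)$ does not have the Stanley--Wilf property. (ii) If $\tau\in\{2413,3142\}$, then $\mathrm{Box}(\tau)$ has the Stanley--Wilf property and is enumerated by the semi-Baxter numbers, i.e. $|\mathrm{Av}_n(\mathrm{Box}(\tau))|=\mathsf{SB}_n$ for all $n\ge0$. (iii) The Stanley--Wilf property remains open for $\tau\in\{2143,3412\}$ (that is, it is not known whether $\mathrm{Box}(\tau)$ has the property); these two cases are equivalent by complement. In particular, no boxed pattern of length at least five has the Stanley--Wilf property.
   Context: $\mathfrak S_n$ is the set of permutations $\pi=\pi_1\cdots\pi_n$ of $\{1,\dots,n\}$. For $\tau\in\mathfrak S_k$, an occurrence of the boxed pattern $\mathrm{Box}(\tau)$ (of length $k$) in $\pi\in\mathfrak S_n$ is a choice of positions $i_1<\cdots<i_k$ such that $\pi_{i_1}\cdots\pi_{i_k}$ is order-isomorphic to $\tau$ and there is no index $j\notin\{i_1,\dots,i_k\}$ with $i_1<j<i_k$ and $\min_r \pi_{i_r}<\pi_j<\max_r\pi_{i_r}$. $\mathrm{Av}_n(P)$ is the set of permutations in $\mathfrak S_n$ with no occurrence of $P$. A pattern $P$ has the Stanley--Wilf property if $\limsup_{n\to\infty}|\mathrm{Av}_n(P)|^{1/n}<\infty$. The complement of $\pi\in\mathfrak S_n$ is the permutation with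 $i$th entry $n+1-\pi_i$; complementation maps occurrences of $\mathrm{Box}(\tau)$ to occurrences of $\mathrm{Box}$ of the complement of $\tau$, and $2143$ and $3412$ are complements of each other. The $n$th semi-Baxter number $\mathsf{SB}_n$ (OEIS A117106) is the number of permutations in $\mathfrak S_n$ avoiding the vincular pattern $2\underline{41}3$; an occurrence of $2\underline{41}3$ is a subsequence $a,b,c,d$ in positional order with $c$ immediately following $b$ in $\pi$ and $c<a<d<b$. *)

(* Defs.v *)
From mathcomp Require Export all_boot all_order all_fingroup all_algebra.
From mathcomp Require Export ereal reals exp sequences.

Set Implicit Arguments.
Unset Strict Implicit.
Unset Printing Implicit Defensive.

(* Permutations of {1, ..., n} are elements of 'S_n, with positions and values
   shifted down by one. [one_line p] shifts the values back up. *)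
Definition one_line n (p : 'S_n) : seq nat := [seq (p i).+1 | i : 'I_n].

Definition complement n (p : 'S_n) : 'S_n :=
  perm (inj_comp (@rev_ord_inj n) (@perm_inj _ p)).

(* For P : pattern, [P n p] means that p contains an occurrence of P. *)
Definition pattern := forall n, pred 'S_n.

Definition Av (P : pattern) n : {set 'S_n} := [set p : 'S_n | ~~ P n p].

Section Box.
Variables (k n : nat) (tau : 'S_k) (p : 'S_n) (i : {ffun 'I_k -> 'I_n}).

Definition increasing_positions : bool :=
  [forall r : 'I_k, forall s : 'I_k, (r < s) ==> (i r < i s)].

Definition order_isomorphic : bool :=
  [forall r : 'I_k, forall s : 'I_k, (p (i r) < p (i s)) == (tau r < tau s)].

(* For increasing i and k > 0, the least and the greatest of the positions i r
   are the first and the last one. The default value n of the minima exceeds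
   every position and every value, so it only matters when k = 0. *)
Definition in_box (j : 'I_n) : bool :=
  (\big[minn/n]_(r < k) i r < j < \max_(r < k) i r) &&
  (\big[minn/n]_(r < k) p (i r) < p j < \max_(r < k) p (i r)).

Definition box_occurrence : bool :=
  [&& increasing_positions, order_isomorphic &
      ~~ [exists j : 'I_n, (j \notin codom i) && in_box j]].

End Box.

Definition Box k (tau : 'S_k) : pattern :=
  fun n p => [exists i : {ffun 'I_k -> 'I_n}, box_occurrence tau p i].

Definition vincular_2_41_3 : pattern := fun n p =>
  [exists a : 'I_n, exists b : 'I_n, exists c : 'I_n, exists d : 'I_n,
    [&& a < b, c == b.+1 :> nat, c < d &
        [&& p c < p a, p a < p d & p d < p b]]].

Definition semi_Baxter n : nat := #|Av vincular_2_41_3 n|.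

(* The term for n = 0 is irrelevant to the limit superior. *)
Definition Stanley_Wilf (R : realType) (P : pattern) : Prop :=
  (limn_esup (fun n => ((#|Av P n|%:R : R) `^ (n%:R^-1))%:E) < +oo)%E.

(* Main.v *)
Require Import Defs.
From mathcomp Require Import boolp classical_sets normedtype zify.

(** An occurrence of Box(tau) in p amounts to an axis-parallel rectangle in the
    plot of p that contains exactly k points, forming a copy of tau: the
    rectangle is the bounding box of the occurrence.

    Factorially many avoiders. Call an entry of tau interior if it is neither
    the first, the last, the least nor the greatest one. In length 4 the
    permutations without an interior entry are exactly 2143, 3412, 2413 and
    3142, and from length 5 on an interior entry always exists, since at most
    four entries are extremal ([interior_entry]). Replace every point of a
    permutation s of length n/2 by two points that are adjacent both in
    position and in value, always ascending or always descending, and add a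
    last greatest point if n is odd ([inflate]). A point strictly inside a
    rectangle has its twin in the closed rectangle, so in an occurrence of
    Box(tau) each interior entry of tau has a twin in tau as well
    ([box_twins]). No entry has both an ascending and a descending twin
    ([twins_desc_excl]); hence for one of the two directions all the (n/2)!
    inflations avoid Box(tau) ([Av_Box_ge_half_fact]). This outgrows every C^n.

    The patterns 2413 and 3142. Box(2413) and the vincular pattern 2-41-3 have
    the same avoiders. Both containments are equivalent to the existence of a
    copy of 2413 with empty bounding box: a box can be emptied by shrinking it,
    as long as the part between the positions of 4 and 1 is empty, which holds
    when 4 and 1 are adjacent ([empty_box_2413]); conversely an empty box
    forces a descent that jumps over it ([vincular_2_41_3P]). The case of 3142
    follows by complementation.

    Exponential growth of the avoiders of 2-41-3. They form a generating tree:
    a child is obtained by appending a last entry. If k of the values that can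
    be appended lie below the last entry and h above it, the children carry
    labels bounded by (i, h + 1) for 1 <= i <= k and (k + r, h - r + 1) for
    1 <= r <= h. With the weight 2^k 4^h the children of a node weigh at most
    12 times as much as the node ([sum_weight_append]), so there are at most
    12^n avoiders of length n ([card_Av_vincular_le]). *)

Set Implicit Arguments.
Unset Strict Implicit.
Unset Printing Implicit Defensive.

Import Order.TTheory GRing.Theory Num.Theory.

(** * Occurrences of boxed patterns and their complements *)

(** Since [minn] with default [n] is not a monoid law, this is proved by
    induction on the enumeration of the index type. *)
Lemma big_minn_lt n m (I : finType) (F : I -> nat) : m <= n ->
  reflect (exists r, F r < m) (\big[minn/n]_r F r < m).
Proof.
move=> le_mn; have bigE (s : seq I) :
    (\big[minn/n]_(r <- s) F r < m) = has (fun r => F r < m) s.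
  elim: s => [|r s IHs]; first by rewrite big_nil ltnNge le_mn.
  by rewrite big_cons gtn_min IHs.
rewrite bigE; apply: (iffP hasP) => [[r _ Fr]|[r Fr]]; first by exists r.
by exists r; rewrite // mem_index_enum.
Qed.

Lemma lt_big_maxn m (I : finType) (F : I -> nat) :
  reflect (exists r, m < F r) (m < \max_r F r).
Proof.
have bigE (s : seq I) :
    (m < \max_(r <- s) F r) = has (fun r => m < F r) s.
  elim: s => [|r s IHs]; first by rewrite big_nil.
  by rewrite big_cons leq_max IHs.
rewrite bigE; apply: (iffP hasP) => [[r _ Fr]|[r Fr]]; first by exists r.
by exists r; rewrite // mem_index_enum.
Qed.

(** This description of the open bounding box is visibly symmetric under
    complementation, which exchanges its last two conditions. *)
Lemma in_boxP k n (p : 'S_n) (i : {ffun 'I_k -> 'I_n}) (j : 'I_n) :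
  reflect ([/\ exists r, i r < j, exists r, j < i r,
               exists r, p (i r) < p j & exists r, p j < p (i r)])
          (in_box p i j).
Proof.
have le_n (j' : 'I_n) : j' <= n := ltnW (ltn_ord j').
apply: (iffP andP) => [[/andP[] /big_minn_lt a /lt_big_maxn b]|[a b c d]].
  by move=> /andP[] /big_minn_lt c /lt_big_maxn d; split; auto.
split; apply/andP; split; try (exact/lt_big_maxn); exact/big_minn_lt.
Qed.

Lemma box_occurrenceP k n (tau : 'S_k) (p : 'S_n) (i : {ffun 'I_k -> 'I_n}) :
  reflect [/\ forall r s : 'I_k, r < s -> i r < i s,
              forall r s : 'I_k, (p (i r) < p (i s)) = (tau r < tau s) &
              forall j, in_box p i j -> j \in codom i]
          (box_occurrence tau p i).
Proof.
apply: (iffP and3P) => -[].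
  move=> /'forall_'forall_implyP incr /'forall_'forall_eqP iso /existsPn box.
  by split=> // j jbox; move: (box j); rewrite jbox andbT negbK.
move=> incr iso box; split; first exact/'forall_'forall_implyP.
  exact/'forall_'forall_eqP.
by apply/existsPn => j; apply/andP => -[/negP + /box].
Qed.

Lemma complementE n (p : 'S_n) j : complement p j = rev_ord (p j).
Proof. by rewrite permE. Qed.

Lemma complementK n : involutive (@complement n).
Proof. by move=> p; apply/permP => j; rewrite !complementE rev_ordK. Qed.

Lemma lt_complement n (p : 'S_n) i j :
  (complement p i < complement p j) = (p j < p i).
Proof.
by rewrite !complementE /=; move: (ltn_ord (p i)) (ltn_ord (p j)); lia.
Qed.

(** Complementation reverses the values of both [tau] and [p] and leaves the
    positions in place, so the same [i] is an occurrence. *)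
Lemma Box_complement k (tau : 'S_k) n (p : 'S_n) :
  Box (complement tau) (complement p) = Box tau p.
Proof.
suff imp (t : 'S_k) (q : 'S_n) : Box t q -> Box (complement t) (complement q).
  by apply/idP/idP => /imp //; rewrite !complementK.
move=> /existsP[i /box_occurrenceP[incr iso box]]; apply/existsP; exists i.
apply/box_occurrenceP; split=> // [r s|j /in_boxP[a b]].
  by rewrite !lt_complement.
move=> [r +] [s +]; rewrite !lt_complement => c d.
by apply/box/in_boxP; split=> //; [exists s|exists r].
Qed.

Lemma Av_Box_complement k (tau : 'S_k) n :
  Av (Box (complement tau)) n = [set complement p | p in Av (Box tau) n].
Proof.
apply/setP => p; apply/idP/imsetP => [|[q + ->]].
  rewrite inE => avp; exists (complement p); last by rewrite complementK.
  by rewrite inE -Box_complement complementK.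
by rewrite !inE Box_complement.
Qed.

Lemma card_Av_Box_complement k (tau : 'S_k) n :
  #|Av (Box (complement tau)) n| = #|Av (Box tau) n|.
Proof.
by rewrite Av_Box_complement card_imset //; apply/inv_inj/complementK.
Qed.

Lemma size_one_line k (tau : 'S_k) : size (one_line tau) = k.
Proof. by rewrite size_map size_enum_ord. Qed.

Lemma nth_one_line k (tau : 'S_k) (r : 'I_k) :
  nth 0 (one_line tau) r = (tau r).+1.
Proof. by rewrite (nth_map r) ?size_enum_ord // nth_ord_enum. Qed.

Lemma one_line_complement k (tau : 'S_k) :
  one_line (complement tau) = [seq k.+1 - v | v <- one_line tau].
Proof.
rewrite /one_line -map_comp; apply: eq_map => r /=.
by rewrite complementE /=; have := ltn_ord (tau r); lia.
Qed.

Lemma one_lineE k (tau : 'S_k.+1) :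
  one_line tau = [seq (tau (inord m)).+1 | m <- iota 0 k.+1].
Proof.
rewrite /one_line -val_enum_ord -map_comp; apply: eq_map => r /=.
by rewrite inord_val.
Qed.

(** * The Stanley--Wilf property as an exponential bound *)

Lemma Stanley_Wilf_eq_card R (P Q : pattern) :
  (forall n, #|Av P n| = #|Av Q n|) -> Stanley_Wilf R P <-> Stanley_Wilf R Q.
Proof.
move=> eqPQ; rewrite /Stanley_Wilf.
suff -> : (fun n => ((#|Av P n|%:R : R) `^ (n%:R^-1))%:E)%R =
          (fun n => ((#|Av Q n|%:R : R) `^ (n%:R^-1))%:E)%R by [].
by apply/funext => n; rewrite eqPQ.
Qed.

(** Taking nth roots turns a bound [C ^ n] into a bound [C], and a finite limit
    superior bounds the nth roots eventually. *)
Lemma Stanley_WilfP R (P : pattern) :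
  Stanley_Wilf R P <->
  exists C N : nat, forall n, N <= n -> #|Av P n| <= C ^ n.
Proof.
rewrite /Stanley_Wilf /limn_esup limf_esupE.
set f := (fun n : nat => _); split.
  move=> /ereal_inf_lt[_ [V [N _ NV] <-] supV].
  have leV n : N <= n -> (f n <= ereal_sup (f @` V)%classic)%E.
    by move=> leNn; apply: ereal_sup_ubound; exists n; first exact: NV.
  case: (ereal_sup _) supV leV => [r _ leV| //|_ /(_ N (leqnn N))//].
  exists (Num.bound r), N.+1 => n ltNn.
  have := leV n (ltnW ltNn); rewrite /f lee_fin => le_r.
  rewrite -(ler_nat R) natrX.
  have -> : (#|Av P n|%:R = (#|Av P n|%:R `^ n%:R^-1) ^+ n :> R)%R.
    rewrite -powR_mulrn ?powR_ge0 // -powRrM mulVf ?powRr1 //.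
    by rewrite pnatr_eq0 -lt0n; lia.
  apply: lerXn2r; rewrite ?nnegrE ?powR_ge0 //.
  by apply/(le_trans le_r)/ltW/archi_boundP/(le_trans _ le_r)/powR_ge0.
move=> [C [N le_C]].
apply: (@le_lt_trans _ _ C%:R%:E); last exact: ltry.
apply: (@le_trans _ _ (ereal_sup (f @` [set n | N.+1 <= n]))%classic).
  apply: ereal_inf_lbound; exists [set n | N.+1 <= n]%classic => //.
  by exists N.+1.
apply: ge_ereal_sup => _ [n /= ltNn <-]; rewrite lee_fin.
have n0 : (n%:R != 0 :> R)%R by rewrite pnatr_eq0 -lt0n; lia.
have -> : (C%:R = (C ^ n)%:R `^ n%:R^-1 :> R)%R.
  by rewrite natrX -powR_mulrn // -powRrM mulfV ?powRr1.
apply: ge0_ler_powR; rewrite ?nnegrE ?invr_ge0 // ler_nat.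
by apply: le_C; lia.
Qed.

(** The last [m] factors of the factorial are all at least [m]. *)
Lemma leq_exp_fact_double m : m ^ m <= (m.*2)`!.
Proof.
suff le_exp j : m ^ j <= (m + j)`! by rewrite -addnn.
elim: j => [|j IHj]; first by rewrite expn0 fact_gt0.
by rewrite expnS addnS factS leq_mul //; lia.
Qed.

(** At [n = 4 * m] a bound [C ^ n] would give [m ^ m <= (C ^ 4) ^ m]. *)
Lemma not_Stanley_Wilf_half_fact R (P : pattern) :
  (forall n, (n./2)`! <= #|Av P n|) -> ~ Stanley_Wilf R P.
Proof.
move=> leAv /Stanley_WilfP[C [N le_C]].
pose m := (C ^ 4 + N).+1.
have := le_C (m.*2.*2); have := leAv m.*2.*2; rewrite doubleK.
move=> /(leq_trans (leq_exp_fact_double m)) le1 /(_ _)/(leq_trans le1).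
move=> /(_ ltac:(lia)); rewrite (_ : m.*2.*2 = 4 * m); last by lia.
by rewrite expnM leqNgt ltn_exp2r ?ltnS ?leq_addr.
Qed.

(** * Inflations of permutations by pairs of adjacent points *)

(** With [desc] false the two points form an ascent, with [desc] true a
    descent; either of them may come first. *)
Definition twins desc n (p : 'S_n) (i j : 'I_n) : bool :=
  ((j == i.+1 :> nat) || (i == j.+1 :> nat)) &&
  (if (i < j) (+) desc then p j == (p i).+1 :> nat else p i == (p j).+1 :> nat).

(** The two twins would have to be different points, but of the four points
    diagonally adjacent to a given one, an ascending and a descending one always
    share their position or their value. *)
Lemma twins_desc_excl n (p : 'S_n) i j j' :
  twins true p i j -> ~~ twins false p i j'.
Proof.
move=> /andP[adj valj]; apply/negP => /andP[adj' valj'].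
have [eq_j|neq_j] := eqVneq j j'.
  by move: adj adj' valj valj'; rewrite -eq_j; case: ltnP => /=; lia.
have neq_p : p j != p j' :> nat by rewrite (inj_eq val_inj) (inj_eq perm_inj).
have {}neq_j : j != j' :> nat by [].
by move: adj adj' valj valj'; case: (ltnP i j); case: (ltnP i j') => /=; lia.
Qed.

Section Inflation.
Variables (n : nat) (desc : bool).

(** Position [i] belongs to the pair that replaces the point [i./2] of [s]. That
    point does not exist only if [i] is the last position and [n] is odd; the
    value is then the greatest one. *)
Definition inflate_fun (s : 'S_(n./2)) (i : 'I_n) : nat :=
  if insub i./2 is Some a then (s a).*2 + (odd i (+) desc) else i.

Variant inflate_spec (s : 'S_(n./2)) (i : 'I_n) : nat -> Type :=
  | InflatePair (a : 'I_(n./2)) of (i./2 = a :> nat) :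
      inflate_spec s i ((s a).*2 + (odd i (+) desc))
  | InflateLast of i = n.-1 :> nat & odd n : inflate_spec s i n.-1.

Lemma inflateP s i : inflate_spec s i (inflate_fun s i).
Proof.
rewrite /inflate_fun; case: insubP => [a _ ia|]; first exact: InflatePair.
move=> nlt; have lt_in := ltn_ord i.
have [on ei] : odd n /\ i = n.-1 :> nat by lia.
by rewrite ei; apply: InflateLast.
Qed.

Lemma inflate_lt s i : inflate_fun s i < n.
Proof. by case: inflateP => [a _|]; [have := ltn_ord (s a)|]; lia. Qed.

Lemma inflate_pos_inj s : injective (fun i => Ordinal (inflate_lt s i)).
Proof.
move=> i j /(congr1 val) /=.
case: inflateP => [a ia|ei on]; case: inflateP => [b jb|ej on'].
- move=> eq_ab; have eq_s : s a = s b by apply: val_inj => /=; lia.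
  by apply: val_inj => /=; move/perm_inj: eq_s ia jb eq_ab => -> /=; lia.
- by have := ltn_ord (s a); lia.
- by have := ltn_ord (s b); lia.
- by move=> _; apply: val_inj; rewrite /= ei ej.
Qed.

Definition inflate s : 'S_n := perm (@inflate_pos_inj s).

Lemma inflateE s i : inflate s i = inflate_fun s i :> nat.
Proof. by rewrite permE. Qed.

Lemma inflate_injective : injective inflate.
Proof.
move=> s t eq_st; apply/permP => a.
have lt_an : a.*2 < n by have := ltn_ord a; lia.
have := congr1 (fun p : 'S_n => val (p (Ordinal lt_an))) eq_st.
rewrite /= !inflateE /inflate_fun /= doubleK valK odd_double.
by move=> eq_a; apply: val_inj => /=; lia.
Qed.

(** Only the extra point in the top right corner has no twin, and nothing lies
    to the right of it; having points to the right and above excludes it. *)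
Lemma inflate_twins s (i u v : 'I_n) : i < u -> inflate s i < inflate s v ->
  exists j, twins desc (inflate s) i j.
Proof.
have lt_un := ltn_ord u; have lt_vn := ltn_ord (inflate s v).
move=> lt_iu; rewrite (inflateE s i) => lt_iv.
have lt_in : i < (n./2).*2.
  by move: lt_iv; case: inflateP => [a|]; [have := ltn_ord a|]; lia.
have lt_jn : (if odd i then i.-1 else i.+1) < n by case: ifP; lia.
have lt_an : i./2 < n./2 by lia.
pose j := Ordinal lt_jn; pose a := Ordinal lt_an.
have half_j : j./2 = i./2 by rewrite /=; case: ifP; lia.
have odd_j : odd j = ~~ odd i by rewrite /=; case: ifP; lia.
have pE (u' : 'I_n) : u'./2 = i./2 ->
    inflate s u' = (s a).*2 + (odd u' (+) desc) :> nat.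
  by move=> half_u; rewrite inflateE /inflate_fun half_u insubT.
exists j; rewrite /twins !pE // odd_j.
have : (i < j) = ~~ odd i by rewrite /=; case: ifP; lia.
by move=> -> /=; case: (boolP (odd i)) => odd_i; case: (desc) => /=; lia.
Qed.

End Inflation.

Definition interior k (tau : 'S_k) (r : 'I_k) : Prop :=
  [/\ 0 < r, r.+1 < k, 0 < tau r & (tau r).+1 < k].

(** The twin of an interior point of the occurrence lies in the closed bounding
    box, hence is itself a point of the occurrence. Points of the occurrence
    that are adjacent in [p] are adjacent in [tau]. *)
Lemma box_twins desc k (tau : 'S_k) n s (i : {ffun 'I_k -> 'I_n}) r :
  interior tau r -> box_occurrence tau (inflate desc s) i ->
  exists r', twins desc tau r r'.
Proof.
set p := inflate desc s => -[r0 rk t0 tk] /box_occurrenceP[incr iso box].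
have k0 : 0 < k by lia.
have lt_k1k : k.-1 < k by lia.
pose first : 'I_k := Ordinal k0; pose last : 'I_k := Ordinal lt_k1k.
pose bot := tau^-1%g first; pose top := tau^-1%g last.
have lo : i first < i r by apply: incr.
have hi : i r < i last by apply: incr => /=; lia.
have vlo : p (i bot) < p (i r) by rewrite iso permKV.
have vhi : p (i r) < p (i top) by rewrite iso permKV /=; lia.
have incr_lt u v : (i u < i v) = (u < v).
  apply/idP/idP; last exact: incr.
  apply: contraTT; rewrite -!leqNgt leq_eqVlt.
  by move=> /predU1P[/val_inj->//|/incr/ltnW].
have [j tw] := inflate_twins hi vhi.
have neq_j u : j <> i u -> j != i u :> nat by move=> h; apply/eqP => /val_inj.
have neq_pj u : j <> i u -> p j != p (i u) :> nat.
  by move=> h; apply/eqP => /val_inj/perm_inj.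
have [r' jr'] : exists r', j = i r'.
  apply/codomP.
  case: (boolP (j \in codom i)) => // nj; case/negP: (nj); apply: box.
  have nju u : j <> i u by move=> ju; rewrite ju codom_f in nj.
  have := tw; rewrite /twins -/p => /andP[adj valj].
  apply/in_boxP; split.
  - exists first; have := neq_j _ (nju first); lia.
  - exists last; have := neq_j _ (nju last); lia.
  - exists bot; have := neq_pj _ (nju bot); case: ifP valj; lia.
  - exists top; have := neq_pj _ (nju top); case: ifP valj; lia.
(* A further entry of [tau] in between would have its point strictly between
   two adjacent ones. *)
have succ_pos u v : i v = (i u).+1 :> nat -> v = u.+1 :> nat.
  move=> i_succ; have lt_uv : u < v by rewrite -incr_lt i_succ.
  have lt_u1 : u.+1 < k by have := ltn_ord v; lia.
  have := incr_lt u (Ordinal lt_u1); have := incr_lt (Ordinal lt_u1) v.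
  by rewrite i_succ /=; lia.
have succ_val u v : p (i v) = (p (i u)).+1 :> nat -> tau v = (tau u).+1 :> nat.
  move=> p_succ; have lt_uv : tau u < tau v by rewrite -iso p_succ.
  have lt_u1 : (tau u).+1 < k by have := ltn_ord (tau v); lia.
  have := iso u (tau^-1%g (Ordinal lt_u1)).
  have := iso (tau^-1%g (Ordinal lt_u1)) v.
  by rewrite permKV p_succ /=; lia.
exists r'; move: tw; rewrite /twins -/p jr' incr_lt => /andP[adj valj].
apply/andP; split.
  by case/orP: adj => /eqP/succ_pos/eqP -> //; rewrite orbT.
by move: valj; case: ifP => _ /eqP/succ_val/eqP.
Qed.

(** At most four entries are extremal, which leaves only length 4, where each
    position and each value at the boundary has to account for one entry. *)
Lemma interior_entry k (tau : 'S_k) : 4 <= k ->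
  one_line tau \notin
    [:: [:: 2; 1; 4; 3]; [:: 3; 4; 1; 2]; [:: 2; 4; 1; 3]; [:: 3; 1; 4; 2]] ->
  exists r, interior tau r.
Proof.
move=> k4 exc; have lt0k : 0 < k by lia.
have ltk1k : k.-1 < k by lia.
pose lo := Ordinal lt0k; pose hi := Ordinal ltk1k.
have interiorP r :
    r \notin [:: lo; hi; tau^-1%g lo; tau^-1%g hi] -> exists r, interior tau r.
  rewrite !inE !negb_or -!(can2_eq (permK tau) (permKV tau)).
  move=> /and4P[rlo rhi tlo thi]; exists r.
  have neq (x y : 'I_k) : x != y -> x <> y :> nat by move=> /eqP nxy /val_inj.
  move: rlo rhi tlo thi => /neq/= rlo /neq/= rhi /neq/= tlo /neq/= thi.
  by split; have := ltn_ord r; have := ltn_ord (tau r); lia.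
case: (pickP (fun r => r \notin [:: lo; hi; tau^-1%g lo; tau^-1%g hi])).
  by move=> r /interiorP.
move=> all_ext.
have ext r : r \in [:: lo; hi; tau^-1%g lo; tau^-1%g hi].
  by have /negbFE := all_ext r.
have : #|'I_k| <= 4.
  rewrite -[4]/(size [:: lo; hi; tau^-1%g lo; tau^-1%g hi]).
  apply: leq_trans (card_size _); apply/subset_leq_card/fintype.subsetP => r _.
  exact: ext.
(* In length 4 the two middle entries are the least and the greatest one, which
   leaves the four listed permutations. *)
rewrite card_ord => k_le4; have Ek : k = 4 by lia.
subst k.
have mid a : 0 < a < 3 -> tau (inord a) = 0 :> nat \/ tau (inord a) = 3 :> nat.
  move=> a_mid; have := ext (inord a).
  rewrite !inE -!(can2_eq (permK tau) (permKV tau)).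
  by case/or4P => /eqP/(congr1 val) /=; rewrite ?inordK; lia.
have neq a b : a < b < 4 -> tau (inord a) <> tau (inord b) :> nat.
  by move=> ab /val_inj/perm_inj/(congr1 val); rewrite /= !inordK; lia.
have := (neq 0 1 isT, neq 0 2 isT, neq 0 3 isT).
have := (neq 1 2 isT, neq 1 3 isT, neq 2 3 isT).
have := (ltn_ord (tau (inord 0)), ltn_ord (tau (inord 3))).
move: exc (mid 1 isT) (mid 2 isT); rewrite one_lineE /=.
move: (tau _ : nat) (tau _ : nat) (tau _ : nat) (tau _ : nat) => d c b a.
move=> exc mid1 mid2 [lt_a lt_d] [[bc bd] cd] [[ab ac] ad].
have [[eb ec]|[eb ec]] : b = 0 /\ c = 3 \/ b = 3 /\ c = 0 by lia.
  have [[ea ed]|[ea ed]] : a = 1 /\ d = 2 \/ a = 2 /\ d = 1 by lia.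
    by rewrite ea eb ec ed in exc.
  by rewrite ea eb ec ed in exc.
have [[ea ed]|[ea ed]] : a = 1 /\ d = 2 \/ a = 2 /\ d = 1 by lia.
  by rewrite ea eb ec ed in exc.
by rewrite ea eb ec ed in exc.
Qed.

(** The interior entry [r] lacks twins of one of the two kinds; the inflations
    of that kind avoid the pattern. *)
Lemma Av_Box_ge_half_fact k (tau : 'S_k) r n :
  interior tau r -> (n./2)`! <= #|Av (Box tau) n|.
Proof.
move=> int_r.
have [desc notwin] : exists desc, forall r', ~~ twins desc tau r r'.
  case: (pickP (twins true tau r)) => [r' tw|none].
    by exists false => r''; apply: twins_desc_excl tw.
  by exists true => r'; rewrite none.
rewrite -card_Sn -(card_imset _ (@inflate_injective n desc)).
apply/subset_leq_card/fintype.subsetP => _ /imsetP[s _ ->]; rewrite inE.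
apply/negP => /existsP[i /(box_twins int_r)[r' tw]].
by have := notwin r'; rewrite tw.
Qed.

(** * Boxed 2413 and the vincular pattern 2-41-3 *)

Definition occ2413 n (p : 'S_n) (a b c d : 'I_n) : bool :=
  [&& a < b < c, c < d, p c < p a < p d & p d < p b].

(** The rectangle strictly between the positions [l] and [r] and strictly
    between the values at [bot] and [top] contains no point. *)
Definition empty_column n (p : 'S_n) (l r bot top : 'I_n) : Prop :=
  forall j : 'I_n, l < j < r -> ~~ (p bot < p j < p top).

Lemma last_ord n (P : pred 'I_n) (j0 : 'I_n) : P j0 ->
  exists2 j, P j & forall i : 'I_n, j < i -> ~~ P i.
Proof.
move=> Pj0; case: (arg_maxnP (fun i : 'I_n => i : nat) Pj0) => j Pj maxj.
by exists j => // i; rewrite ltnNge; apply: contra => /maxj.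
Qed.

Lemma first_ord n (P : pred 'I_n) (j0 : 'I_n) : P j0 ->
  exists2 j, P j & forall i : 'I_n, i < j -> ~~ P i.
Proof.
move=> Pj0; case: (arg_minnP (fun i : 'I_n => i : nat) Pj0) => j Pj minj.
by exists j => // i; rewrite ltnNge; apply: contra => /minj.
Qed.

(** Emptying the bounding box. As long as it contains a further point, the copy
    of 2413 can be replaced by one with a smaller box whose middle column is
    still empty. Left of [b], a point below the value of [d] can replace [a]; if
    there is none, the last point between [a] and [b] can replace [b]. The
    points right of [c] are treated in the same way after a half turn. *)
Lemma empty_box_2413 n (p : 'S_n) a b c d :
  occ2413 p a b c d -> empty_column p b c c b ->
  exists a' b' c' d', occ2413 p a' b' c' d' /\ empty_column p a' d' c' b'.
Proof.
have [m] := ubnP ((d - a) + (p b - p c)).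
elim: m a b c d => // m IHm a b c d lt_m occ col.
have neq (x y : 'I_n) : x < y -> p x <> p y :> nat.
  by move=> xy /val_inj/perm_inj exy; rewrite exy ltnn in xy.
have /and4P[/andP[ab bc] cd /andP[ca ad] db] := occ.
(* A point that can replace [a]. *)
case: (pickP (fun j : 'I_n => (a < j < b) && (p c < p j < p d))) => [j|noL].
  by move=> hj; apply: (IHm j b c d) => //; rewrite /occ2413; lia.
(* A point that can replace [d]. *)
case: (pickP (fun j : 'I_n => (c < j < d) && (p a < p j < p b))) => [j|noR].
  by move=> hj; apply: (IHm a b c j) => //; rewrite /occ2413; lia.
(* A point that can replace [b]; taking the last one keeps the column empty. *)
pose B (j : 'I_n) := (a < j < b) && (p d < p j < p b).
case: (pickP B) => [j0 /(@last_ord _ B)[j hj lastj]|noB].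
  rewrite /B in hj lastj; apply: (IHm a j c d).
  - by lia.
  - by rewrite /occ2413; lia.
  move=> i /andP[ji ic]; have := noL i; have := lastj i ji; have := col i.
  have := neq i d; have [ib|bi|/val_inj ->] := ltngtP i b; lia.
(* A point that can replace [c]; taking the first one keeps the column empty. *)
pose C (j : 'I_n) := (c < j < d) && (p c < p j < p a).
case: (pickP C) => [j0 /(@first_ord _ C)[j hj firstj]|noC].
  rewrite /C in hj firstj; apply: (IHm a b j d).
  - by lia.
  - by rewrite /occ2413; lia.
  move=> i /andP[bi ij]; have := noR i; have := firstj i ij; have := col i.
  have := neq a i; have [ib|bi'|/val_inj ->] := ltngtP i c; lia.
exists a, b, c, d; split=> // j /andP[aj jd].
have [-> | /eqP jb] := eqVneq j b; first by rewrite ltnn andbF.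
have [-> | /eqP jc] := eqVneq j c; first by rewrite ltnn.
have {}jb : j <> b :> nat by move=> /val_inj.
have {}jc : j <> c :> nat by move=> /val_inj.
have := noL j; have := noR j; have := noB j; have := noC j; rewrite /B /C.
by have := col j; have := neq j d; have := neq a j; lia.
Qed.

Lemma nth_2413 (tau : 'S_4) : one_line tau = [:: 2; 4; 1; 3] ->
  forall r s : 'I_4, (tau r < tau s) =
    (nth 0 [:: 2; 4; 1; 3] r < nth 0 [:: 2; 4; 1; 3] s).
Proof. by move=> <- r s; rewrite !nth_one_line. Qed.

Lemma Box_2413P (tau : 'S_4) n (p : 'S_n) : one_line tau = [:: 2; 4; 1; 3] ->
  reflect (exists a b c d, occ2413 p a b c d /\ empty_column p a d c b)
          (Box tau p).
Proof.
move=> tauE; have tau_lt := nth_2413 tauE.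
pose o m : 'I_4 := inord m.
have oE m : m < 4 -> o m = m :> nat by move=> lt_m; rewrite inordK.
have ord4 (r : 'I_4) : [\/ r = o 0, r = o 1, r = o 2 | r = o 3].
  rewrite -(inord_val r) /o; case: r => -[|[|[|[|//]]]] _ /=.
  - exact: Or41.
  - exact: Or42.
  - exact: Or43.
  - exact: Or44.
rewrite /Box; apply: (iffP existsP) => [[i /box_occurrenceP[incr iso box]]|].
  have pos r s : r < s < 4 -> i (o r) < i (o s).
    by move=> rs; apply: incr; rewrite !oE; lia.
  have val r s : r < 4 -> s < 4 -> (p (i (o r)) < p (i (o s))) =
      (nth 0 [:: 2; 4; 1; 3] r < nth 0 [:: 2; 4; 1; 3] s).
    by move=> r4 s4; rewrite iso tau_lt !oE.
  exists (i (o 0)), (i (o 1)), (i (o 2)), (i (o 3)); split.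
    by rewrite /occ2413 !val ?pos.
  move=> j lt_j; apply/negP => lt_pj.
  have /codomP[r jr] : j \in codom i.
    have [/andP[j0 j3] /andP[j2 j1]] := (lt_j, lt_pj).
    by apply/box/in_boxP; split;
      [exists (o 0)|exists (o 3)|exists (o 2)|exists (o 1)].
  move: lt_j lt_pj; rewrite jr.
  by case: (ord4 r) => ->; rewrite ?ltnn ?andbF ?val.
move=> [a [b [c [d [/and4P[/andP[ab bc] cd /andP[ca ad] db] col]]]]].
exists [ffun r : 'I_4 => nth a [:: a; b; c; d] r].
apply/box_occurrenceP; split=> [r s|r s|j /in_boxP].
- by rewrite !ffunE; case: (ord4 r) => ->; case: (ord4 s) => ->;
    rewrite !oE //=; lia.
- rewrite !ffunE tau_lt; case: (ord4 r) => ->; case: (ord4 s) => ->;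
    rewrite !oE //=; lia.
move=> [[r1 +] [r2 +] [r3 +] [r4 +]]; rewrite !ffunE => j1 j2 j3 j4.
have /col : a < j < d.
  apply/andP; split.
    by move: j1; case: (ord4 r1) => ->; rewrite oE //=; lia.
  by move: j2; case: (ord4 r2) => ->; rewrite oE //=; lia.
case/negP; apply/andP; split.
  by move: j3; case: (ord4 r3) => ->; rewrite oE //=; lia.
by move: j4; case: (ord4 r4) => ->; rewrite oE //=; lia.
Qed.

Lemma vincularP n (p : 'S_n) :
  reflect (exists a b c d : 'I_n, [&& a < b, c == b.+1 :> nat, c < d &
             [&& p c < p a, p a < p d & p d < p b]])
          (vincular_2_41_3 p).
Proof.
apply: (iffP existsP) => [[a /existsP[b /existsP[c /existsP[d occ]]]]|].
  by exists a, b, c, d.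
move=> [a [b [c [d occ]]]]; exists a; apply/existsP; exists b.
by apply/existsP; exists c; apply/existsP; exists d.
Qed.

(** If the box is empty, the last entry before [c] that is at least as large as
    the entry at [b] is followed by an entry that is at most as large as the one
    at [c]; these two entries serve as the adjacent 41. *)
Lemma vincular_2_41_3P n (p : 'S_n) :
  reflect (exists a b c d, occ2413 p a b c d /\ empty_column p a d c b)
          (vincular_2_41_3 p).
Proof.
apply: (iffP (vincularP p)) => [[a [b [c [d]]]]|].
  move=> /and4P[ab /eqP bc cd occ]; apply: (@empty_box_2413 _ _ a b c d).
    by rewrite /occ2413; lia.
  by move=> j; lia.
move=> [a [b [c [d [/and4P[/andP[ab bc] cd /andP[ca ad] db] col]]]]].
have [b' /andP[b'c le_bb'] lastb'] :=
  @last_ord _ (fun j : 'I_n => (j < c) && (p b <= p j)) b ltac:(lia).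
have b'b : b <= b'.
  by rewrite leqNgt; apply/negP => /lastb'; lia.
have ltc : b'.+1 < n by have := ltn_ord c; lia.
pose c' := Ordinal ltc.
exists a, b', c', d.
have le_c'c : p c' <= p c.
  have [-> //|/eqP c'c] := eqVneq c' c.
  have {}c'c : c' <> c :> nat by move=> /val_inj.
  have neq : p c' <> p c :> nat by move=> /val_inj/perm_inj/(congr1 val).
  by have := lastb' c'; have := col c'; rewrite /= in c'c *; lia.
by rewrite /=; lia.
Qed.

Lemma Av_Box_2413 k (tau : 'S_k) n : one_line tau = [:: 2; 4; 1; 3] ->
  Av (Box tau) n = Av vincular_2_41_3 n.
Proof.
move=> tauE; have Ek : k = 4 by rewrite -(size_one_line tau) tauE.
subst k; apply/setP => p; rewrite !inE; congr (~~ _).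
exact: sameP (Box_2413P p tauE) (vincular_2_41_3P p).
Qed.

(** * An exponential bound for the avoiders of 2-41-3 *)

(** The entries of [s] that are at least [v] move up by one. *)
Definition append n (s : 'S_n) (v : 'I_n.+1) : 'S_n.+1 := lift_perm ord_max v s.

Lemma append_max n (s : 'S_n) v : append s v ord_max = v.
Proof. exact: lift_perm_id. Qed.

Lemma append_lift n (s : 'S_n) v i :
  append s v (lift ord_max i) = bump v (s i) :> nat.
Proof. by rewrite /append lift_perm_lift. Qed.

(** The parent of a permutation and the value of its last entry determine it, so the map is
    injective, and both sides have [n.+1`!] elements. *)
Lemma append_bij n :
  bijective (fun sv : 'S_n * 'I_n.+1 => append sv.1 sv.2).
Proof.
apply: inj_card_bij => [[s v] [t w] /= eq_app|].
  have eq_vw : v = w by rewrite -(append_max s v) eq_app append_max.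
  congr (_, _) => //; apply/permP => i; apply: (@lift_inj _ v).
  have := congr1 (fun p : 'S_n.+1 => p (lift ord_max i)) eq_app.
  by rewrite /append !lift_perm_lift eq_vw.
by rewrite card_prod !card_Sn card_ord factS mulnC.
Qed.

(** Appending [v] to [s] makes [v] the last entry of a copy of 2-41-3 whose
    other entries are at [a], [b] and [c]. The second inequality is weak because
    an entry of value [v] moves up when [v] is appended. *)
Definition forbidden n (s : 'S_n) (v : nat) : bool :=
  [exists a : 'I_n, exists b : 'I_n, exists c : 'I_n,
    [&& a < b, c == b.+1 :> nat, s c < s a & s a < v <= s b]].

Lemma forbiddenP n (s : 'S_n) v :
  reflect (exists a b c : 'I_n,
             [&& a < b, c == b.+1 :> nat, s c < s a & s a < v <= s b])
          (forbidden s v).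
Proof.
apply: (iffP existsP) => [[a /existsP[b /existsP[c occ]]]|[a [b [c occ]]]].
  by exists a, b, c.
by exists a; apply/existsP; exists b; apply/existsP; exists c.
Qed.

(** A new copy of 2-41-3 uses the appended entry, which can only be its 3, as no
    other entry of the pattern comes last. *)
Lemma vincular_append n (s : 'S_n) v :
  vincular_2_41_3 (append s v) = vincular_2_41_3 s || forbidden s v.
Proof.
have lt_lift (i : 'I_n) : lift ord_max i < n by rewrite lift_max.
apply/vincularP/orP => [[a [b [c [d]]]]|[/vincularP|/forbiddenP]].
- have [d' ->|->] := unliftP ord_max d; last first.
    have [c' ->|->] := unliftP ord_max c; last by rewrite ltnn !andbF.
    have [b' ->|->] := unliftP ord_max b; last first.
      by move=> /and4P[_ /eqP ec]; have := lt_lift c'; rewrite ec ltnNge leqnSn.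
    have [a' ->|->] := unliftP ord_max a; last first.
      by move=> /andP[/ltn_trans/(_ (lt_lift b'))]; rewrite /= ltnn.
    rewrite append_max !append_lift !lift_max => occ; right.
    by apply/forbiddenP; exists a', b', c'; rewrite /bump in occ; lia.
  have [c' ->|->] := unliftP ord_max c; last first.
    by move=> /and4P[_ _ /ltn_trans/(_ (lt_lift d'))]; rewrite /= ltnn.
  have [b' ->|->] := unliftP ord_max b; last first.
    by move=> /and4P[_ /eqP ec]; have := lt_lift c'; rewrite ec ltnNge leqnSn.
  have [a' ->|->] := unliftP ord_max a; last first.
    by move=> /andP[/ltn_trans/(_ (lt_lift b'))]; rewrite /= ltnn.
  rewrite !append_lift !lift_max => occ; left.
  by apply/vincularP; exists a', b', c', d'; rewrite /bump in occ; lia.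
- move=> [a [b [c [d occ]]]].
  exists (lift ord_max a), (lift ord_max b), (lift ord_max c), (lift ord_max d).
  by rewrite !append_lift !lift_max /bump; lia.
move=> [a [b [c occ]]].
exists (lift ord_max a), (lift ord_max b), (lift ord_max c), ord_max.
by rewrite append_max !append_lift !lift_max /bump /=; have := ltn_ord c; lia.
Qed.

(** The value [v - (j < v)] is what [v] amounts to before [j] is appended. *)
Lemma forbidden_append n (s : 'S_n) (j : 'I_n.+1) v :
  forbidden s (v - (j < v)) -> forbidden (append s j) v.
Proof.
move=> /forbiddenP[a [b [c occ]]]; apply/forbiddenP.
exists (lift ord_max a), (lift ord_max b), (lift ord_max c).
by rewrite !append_lift !lift_max /bump; lia.
Qed.

(** The appended entry is the bottom of a descent from the last entry of [s].
    With the old entry of value [j], which lies above it by one, this descent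
    forms the 2-41 of a copy of 2-41-3. *)
Lemma forbidden_descent n (s : 'S_n.+1) (j : 'I_n.+2) v :
  j.+1 < v <= (s ord_max).+1 -> forbidden (append s j) v.
Proof.
move=> jv; have lt_j : j < n.+1 by have := ltn_ord (s ord_max); lia.
(* The entry of value [j] moves up to [j.+1], below [v]. *)
pose a := s^-1%g (Ordinal lt_j).
have sa : s a = j :> nat by rewrite permKV.
have a_max : a < n.
  have : a != ord_max.
    by apply/eqP => ea; move: sa jv; rewrite ea; lia.
  by rewrite -(inj_eq val_inj) /=; have := ltn_ord a; lia.
apply/forbiddenP; exists (lift ord_max a), (lift ord_max ord_max), ord_max.
by rewrite append_max !append_lift !lift_max sa /bump /=; lia.
Qed.

Section Weight.
Variable g : pred nat.

Definition sites a b : nat := \sum_(a <= v < b) g v.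

Lemma sites_cat b a c : a <= b <= c -> sites a c = sites a b + sites b c.
Proof. by move=> /andP[ab bc]; rewrite /sites (big_cat_nat ab bc). Qed.

(** The exponents are 1, 2, 3, ..., so this is a geometric sum. *)
Lemma sum_exp_prefix a b : a <= b ->
  \sum_(a <= j < b | g j) 2 ^ sites a j.+1 <= 2 ^ (sites a b).+1.
Proof.
move=> /subnKC <-; elim: (b - a) => [|m IHm]; first by rewrite addn0 big_geq.
rewrite addnS big_mkcond big_nat_recr ?leq_addr //= -big_mkcond /=.
rewrite [X in _ <= 2 ^ X.+1](sites_cat (b := a + m)); last by lia.
rewrite [sites (a + m) _]/sites big_nat1.
case: ifP => gm; last by rewrite !addn0.
rewrite (sites_cat (b := a + m)) ?leq_addr //=.
rewrite [sites (a + m) _]/sites big_nat1 gm /= addn1.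
by move: IHm; rewrite !expnS; lia.
Qed.

Lemma sum_exp_suffix a b : a <= b ->
  \sum_(a <= j < b | g j) 2 ^ sites j b <= 2 ^ (sites a b).+1.
Proof.
move=> /subnKC <-; move: (b - a) => m.
elim: m a => [|m IHm] a; first by rewrite addn0 big_geq.
rewrite big_ltn_cond; last by lia.
have := IHm a.+1; rewrite addSnnS => IHa.
rewrite [X in _ <= 2 ^ X.+1](sites_cat (b := a.+1)); last by lia.
rewrite [sites a a.+1]/sites big_nat1; case: ifP => ga; last by rewrite add0n.
rewrite (sites_cat (b := a.+1)); last by lia.
rewrite [sites a a.+1]/sites big_nat1 ga.
by move: IHa; rewrite !add1n !expnS; lia.
Qed.

End Weight.

Definition allowed n (s : 'S_n) v := ~~ forbidden s v.
Definition below n (s : 'S_n.+1) := sites (allowed s) 0 (s ord_max).+1.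
Definition above n (s : 'S_n.+1) := sites (allowed s) (s ord_max).+1 n.+2.
Definition weight n (s : 'S_n.+1) := 2 ^ below s * 4 ^ above s.

Lemma below_append n (s : 'S_n.+1) (j : 'I_n.+2) :
  below (append s j) <= sites (allowed s) 0 j.+1.
Proof.
rewrite /below append_max /sites !big_nat; apply: leq_sum => v /andP[_ vj].
rewrite /allowed; have := @forbidden_append _ s j v.
rewrite (_ : j < v = false) ?subn0; last lia.
by case: (forbidden s v) => [/(_ isT) ->|_] //; apply: leq_b1.
Qed.

Lemma above_append n (s : 'S_n.+1) (j : 'I_n.+2) i : j <= i ->
  sites (allowed (append s j)) i.+1 n.+3 <= sites (allowed s) i n.+2.
Proof.
move=> ji.
rewrite /sites big_add1 !big_nat; apply: leq_sum => v /andP[iv _].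
rewrite /allowed; have := @forbidden_append _ s j v.+1.
rewrite (_ : j < v.+1 = true) ?subn1 /=; last lia.
by case: (forbidden s v) => [/(_ isT) ->|_] //; apply: leq_b1.
Qed.

(** Only the value just above the new entry and the values above the previous
    last entry survive a descent. *)
Lemma above_append_descent n (s : 'S_n.+1) (j : 'I_n.+2) : j <= s ord_max ->
  above (append s j) <= (above s).+1.
Proof.
rewrite /above append_max; set l := nat_of_ord (s ord_max) => j_le.
have lt_l : l < n.+1 by apply: ltn_ord.
rewrite (@sites_cat _ l.+2); last by lia.
rewrite (@sites_cat _ j.+2 j.+1); last by lia.
have top : sites (allowed (append s j)) l.+2 n.+3 <= above s.
  by apply: above_append; lia.
have mid : sites (allowed (append s j)) j.+2 l.+2 = 0.
  rewrite /sites big_nat big1 // => v jv.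
  by rewrite /allowed forbidden_descent // -/l; lia.
have bot : sites (allowed (append s j)) j.+1 j.+2 <= 1.
  by rewrite /sites big_nat1 leq_b1.
by rewrite mid addn0; apply: leq_add bot top.
Qed.

(** The descents contribute at most 8 times and the ascents at most 4 times the
    weight of [s]. For an ascent to [j] the powers of 2 and 4 combine: the two
    counts add up to one more than the total, which leaves a second geometric
    sum over [j]. *)
Lemma sum_weight_append n (s : 'S_n.+1) :
  \sum_(j < n.+2 | allowed s j) weight (append s j) <= 12 * weight s.
Proof.
set g := allowed s; set l := nat_of_ord (s ord_max).
have lt_l : l < n.+1 by apply: ltn_ord.
(* In the second case the factor [4 ^ sites g j n.+2] has been split in two and
   one half merged with the power of 2. *)
pose F j := if j <= l then 2 ^ sites g 0 j.+1 * 4 ^ (above s).+1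
            else 2 ^ (below s + above s).+1 * 2 ^ sites g j n.+2.
have le_F (j : 'I_n.+2) : g j -> weight (append s j) <= F j.
  move=> gj; rewrite /weight /F; case: (leqP j l) => lj.
    by apply: leq_mul; rewrite leq_exp2l // ?below_append ?above_append_descent.
  apply: (@leq_trans (2 ^ sites g 0 j.+1 * 4 ^ sites g j n.+2)).
    apply: leq_mul; rewrite leq_exp2l // ?below_append //.
    by rewrite /above append_max above_append.
  rewrite (_ : 4 = 2 ^ 2) // -expnM -!expnD leq_exp2l // /below /above -/l -/g.
  rewrite -(@sites_cat _ l.+1); last by lia.
  rewrite [sites g 0 n.+2](@sites_cat _ j); last by have := ltn_ord j; lia.
  rewrite (@sites_cat _ j 0 j.+1); last by lia.
  by rewrite [sites g j j.+1]/sites big_nat1 gj; lia.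
apply: (@leq_trans (\sum_(j < n.+2 | g j) F j)); first exact: leq_sum.
rewrite -(big_mkord g F) (@big_cat_nat _ _ _ l.+1) //=; last by lia.
have -> : 12 * weight s = 8 * weight s + 4 * weight s by rewrite -mulnDl.
apply: leq_add.
  rewrite big_nat_cond
    (eq_bigr (fun j => 2 ^ sites g 0 j.+1 * 4 ^ (above s).+1)).
    rewrite -big_nat_cond -big_distrl /=.
    apply: leq_trans (leq_mul (sum_exp_prefix g (leq0n l.+1)) (leqnn _)) _.
    by rewrite /weight -/(below s) !expnS; lia.
  by move=> j /andP[jl _]; rewrite /F ifT //; lia.
rewrite big_nat_cond
  (eq_bigr (fun j => 2 ^ (below s + above s).+1 * 2 ^ sites g j n.+2)).
  rewrite -big_nat_cond -big_distrr /=.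
  apply: leq_trans (leq_mul (leqnn _) (sum_exp_suffix g _)) _; first by lia.
  rewrite /weight -/(above s) (_ : 4 ^ above s = 2 ^ above s * 2 ^ above s).
    by rewrite !expnS expnD; lia.
  by rewrite -expnMn.
by move=> j /andP[jl _]; rewrite /F ifF //; lia.
Qed.

Lemma sum_weight_Av n :
  \sum_(s in Av vincular_2_41_3 n.+1) weight s <= 8 * 12 ^ n.
Proof.
elim: n => [|n IHn].
  apply: (@leq_trans (\sum_(s : 'S_1) 8)).
    apply: (@leq_trans (\sum_(s in Av vincular_2_41_3 1) 8)).
      apply: leq_sum => s _; rewrite /weight.
      have s0 : s ord_max = 0 :> nat by have := ltn_ord (s ord_max); lia.
      have -> : 8 = 2 ^ 1 * 4 ^ 1 by [].
      apply: leq_mul; rewrite leq_exp2l // /below /above s0 /sites big_nat1;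
        exact: leq_b1.
    by rewrite !sum_nat_const leq_mul2r max_card.
  by rewrite sum_nat_const card_Sn.
rewrite (reindex _ (onW_bij _ (append_bij n.+1))) /=.
rewrite (eq_bigl (fun sv : 'S_n.+1 * 'I_n.+2 =>
  (sv.1 \in Av vincular_2_41_3 n.+1) && allowed sv.1 sv.2)); last first.
  by move=> [s v]; rewrite !inE vincular_append negb_or.
rewrite -(pair_big_dep _ (fun s (v : 'I_n.+2) => allowed s v)
                       (fun s (v : 'I_n.+2) => weight (append s v))) /=.
apply: (@leq_trans (\sum_(s in Av vincular_2_41_3 n.+1) 12 * weight s)).
  by apply: leq_sum => s _; apply: sum_weight_append.
by rewrite -big_distrr /= expnS mulnCA leq_mul2l IHn.
Qed.

Lemma card_Av_vincular_le n : #|Av vincular_2_41_3 n| <= 12 ^ n.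
Proof.
case: n => [|n].
  by apply: leq_trans (max_card _) _; rewrite card_Sn.
apply: (@leq_trans (8 * 12 ^ n)); last by rewrite expnS leq_mul2r orbT.
apply: leq_trans (sum_weight_Av n); rewrite -sum1_card; apply: leq_sum => s _.
by rewrite muln_gt0 !expn_gt0.
Qed.

(** * The classification of boxed patterns *)

Lemma Stanley_Wilf_vincular R : Stanley_Wilf R vincular_2_41_3.
Proof.
by apply/Stanley_WilfP; exists 12, 0 => n _; apply: card_Av_vincular_le.
Qed.

Lemma card_Av_Box_2413_3142 k (tau : 'S_k) n :
  one_line tau \in [:: [:: 2; 4; 1; 3]; [:: 3; 1; 4; 2]] ->
  #|Av (Box tau) n| = semi_Baxter n.
Proof.
rewrite !inE => /orP[] /eqP tauE; first by rewrite (Av_Box_2413 n tauE).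
have Ek : k = 4 by rewrite -(size_one_line tau) tauE.
rewrite -card_Av_Box_complement (@Av_Box_2413 _ (complement tau)) //.
by rewrite one_line_complement tauE Ek.
Qed.

Theorem theorem4p4 (R : realType) :
  (forall (k : nat) (tau : 'S_k), 4 <= k ->
    [/\ one_line tau \notin
          [:: [:: 2; 1; 4; 3]; [:: 3; 4; 1; 2]; [:: 2; 4; 1; 3]; [:: 3; 1; 4; 2]] ->
          (forall n : nat, (n./2)`! <= #|Av (Box tau) n|) /\
          ~ Stanley_Wilf R (Box tau),
        one_line tau \in [:: [:: 2; 4; 1; 3]; [:: 3; 1; 4; 2]] ->
          Stanley_Wilf R (Box tau) /\
          (forall n : nat, #|Av (Box tau) n| = semi_Baxter n) &
        (one_line tau = [:: 2; 1; 4; 3] <->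
         one_line (complement tau) = [:: 3; 4; 1; 2]) /\
        (one_line tau \in [:: [:: 2; 1; 4; 3]; [:: 3; 4; 1; 2]] ->
          (forall n : nat,
             Av (Box (complement tau)) n =
             [set complement p | p in Av (Box tau) n]) /\
          (Stanley_Wilf R (Box tau) <-> Stanley_Wilf R (Box (complement tau))))])
  /\
  (forall (k : nat) (tau : 'S_k), 5 <= k -> ~ Stanley_Wilf R (Box tau)).
Proof.
have part1 k (tau : 'S_k) : 4 <= k -> one_line tau \notin
      [:: [:: 2; 1; 4; 3]; [:: 3; 4; 1; 2]; [:: 2; 4; 1; 3]; [:: 3; 1; 4; 2]] ->
    (forall n : nat, (n./2)`! <= #|Av (Box tau) n|) /\
    ~ Stanley_Wilf R (Box tau).
  move=> k4 exc; have [r int_r] := interior_entry k4 exc.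
  have le_fact n := Av_Box_ge_half_fact n int_r.
  by split=> //; apply: not_Stanley_Wilf_half_fact.
split=> [k tau k4|k tau k5].
  split; first exact: part1.
    move=> tau_in; split=> [|n]; last exact: card_Av_Box_2413_3142.
    apply/(@Stanley_Wilf_eq_card R _ vincular_2_41_3).
      by move=> n; apply: card_Av_Box_2413_3142.
    exact: Stanley_Wilf_vincular.
  split; last first.
    move=> _; split=> [n|]; first exact: Av_Box_complement.
    by apply: Stanley_Wilf_eq_card => n; rewrite card_Av_Box_complement.
  have size4 (s : seq nat) (t : 'S_k) : one_line t = s -> k = size s.
    by move=> <-; rewrite size_one_line.
  split=> tauE.
    by rewrite one_line_complement tauE (size4 _ _ tauE).
  rewrite -[tau]complementK one_line_complement tauE.
  by rewrite (size4 _ _ tauE).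
have k4 : 4 <= k by lia.
apply: (part1 k tau k4 _).2.
by rewrite !inE; apply/norP; split; [|apply/norP; split; [|apply/norP; split]];
  apply/eqP => tauE; move: k5; rewrite -(size_one_line tau) tauE.
Qed.
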